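(* Let $q$ be a prime power (odd or even), let $\alpha\in\mathbb{F}_q$ be as in the context, and let $n$ be a positive integer. Then the functional graph of $C_n(x,\alpha)$ on $\mathbb{P}^1(\mathbb{F}_q)$ is isomorphic to the functional graph of $x^n$ on $\mu_{q+1}$.
   Context: Let $q$ be a prime power and let $h(x)\in\mathbb{F}_q[x]$ be an irreducible polynomial of the form $x^2-\alpha$ if $q$ is odd, and $x^2+x+\alpha$ if $q$ is even. Let $\beta\in\mathbb{F}_{q^2}$ be a root of $h(x)$ and $\bar\beta:=\beta^q$ the other root. Set $\rho(x):=(x-\bar\beta)/(x-\beta)$ and $\rho^{-1}(x):=(\beta x-\bar\beta)/(x-1)$, which are inverse under composition. The degree-$n$ Rédei function is $R_n(x,\alpha):=\rho^{-1}\circ x^n\circ\rho\in\mathbb{F}_q(x)$. The degree-$n$ tangent-Chebyshev rational function $C_n(x,\alpha)\in\mathbb{F}_q(x)$ is defined as follows. For odd $q$, \[ C_n(x,\alpha):=\frac{\sum_{i=0}^{\lfloor (n-1)/2\rfloor}\binom{n}{2i+1}\alpha^i x^{2i+1}}{\sum_{i=0}^{\lfloor n/2\rfloor}\binom{n}{2i}\alpha^i x^{2i}}. \] For even $q$, $C_n(x,\alpha):=\frac1x\circ R_n(x,\alpha)\circ\frac1x=1/R_n(1/x,\alpha)$. $\mathbb{P}^1(\mathbb{F}_q):=\mathbb{F}_q\cup\{\infty\}$, on which a rational function over $\mathbb{F}_q$ acts as a self-map in the usual way; $\mu_{q+1}$ is the set of $(q+1)$-th roots of unity in $\mathbb{F}_{q^2}$.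 For a set $S$ and a function $f\colon S\to S$, the functional graph of $f$ is the directed graph with vertex set $S$ and an edge from $s$ to $t$ if and only if $f(s)=t$; isomorphism means isomorphism of directed graphs. *)

(* Defs.v *)
From HB Require Import structures.
From mathcomp Require Import all_boot all_order all_algebra all_field.

Set Implicit Arguments.
Unset Strict Implicit.
Unset Printing Implicit Defensive.

Import GRing.Theory.
Local Open Scope ring_scope.
Local Open Scope quotient_scope.

Notation "p %:F" := (FracField.tofrac p) : ring_scope.

Section RatFun.
Variable K : fieldType.
Implicit Types (f g : {fraction {poly K}}) (p d : {poly K}).

(* [ratnum f] / [ratden f] is [f] in lowest terms (up to a common nonzero
   scalar, which none of the definitions below depends on). *)
Definition ratnum f : {poly K} :=
  let r := repr f in \n_r %/ gcdp \n_r \d_r.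

Definition ratden f : {poly K} :=
  let r := repr f in \d_r %/ gcdp \n_r \d_r.

Lemma ratden_neq0 f : ratden f != 0.
Proof.
rewrite /ratden; set r := repr f.
by rewrite divpN0 ?gcdp_eq0 ?negb_and ?denom_ratioP ?orbT // dvdp_leq
  ?denom_ratioP ?dvdp_gcdr.
Qed.

Lemma coprimep_ratnum_ratden f : coprimep (ratnum f) (ratden f).
Proof.
by apply: coprimep_div_gcd; rewrite denom_ratioP orbT.
Qed.

Lemma ratnum_div_ratden f : (ratnum f)%:F / (ratden f)%:F = f.
Proof.
have eqfE n d (d0 : d != 0) : n%:F / d%:F = \pi_({fraction {poly K}}) (Ratio n d).
  apply: (canLR (mulfK _)); first by rewrite tofrac_eq0.
  unlock FracField.tofrac; rewrite -[RHS]FracField.pi_mul.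
  by rewrite /FracField.mulf; apply/eqmodP;
    rewrite /= /equivf /= !numden_Ratio ?mulf_neq0 ?oner_eq0 // ?mulr1 ?mul1r mulrC.
rewrite -[in RHS](reprK f) -[in RHS](Ratio_numden (repr f)).
rewrite -eqfE ?denom_ratioP //.
rewrite /ratnum /ratden; set r := repr f; set c := gcdp _ _.
have c0 : c != 0 by rewrite gcdp_eq0 negb_and denom_ratioP orbT.
have cF0 : c%:F != 0 by rewrite tofrac_eq0.
have := divpK (dvdp_gcdl \n_r \d_r); have := divpK (dvdp_gcdr \n_r \d_r).
rewrite -/c; move: (\n_r %/ c) (\d_r %/ c) => u v <- <-.
by rewrite !tofracM -mulf_div mulfV // mulr1.
Qed.

(* The projective line: [None] is the point at infinity. *)
Definition P1 : Type := option K.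
HB.instance Definition _ := Equality.on P1.

(* With N/D in lowest terms and k the degree of N/D, the value at infinity is
   the quotient of the coefficients of degree k, infinite when D has degree
   less than k. *)
Definition P1_act f (x : P1) : P1 :=
  let N := ratnum f in
  let D := ratden f in
  let k := (maxn (size N) (size D)).-1 in
  match x with
  | Some a => if D.[a] == 0 then None else Some (N.[a] / D.[a])
  | None => if D`_k == 0 then None else Some (N`_k / D`_k)
  end.

Definition ratcst (c : K) : {fraction {poly K}} := c%:P%:F.
HB.instance Definition _ :=
  GRing.RMorphism.copy ratcst (@FracField.tofrac {poly K} \o @polyC K).

(* f(g(x)); when g is a constant which is a pole of f, the composite is the
   constant infinity, not an element of K(x), and the value here is 0. *)
Definition ratcomp f g : {fraction {poly K}} :=
  (map_poly ratcst (ratnum f)).[g] / (map_poly ratcst (ratden f)).[g].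

Lemma ratcomp_frac p d g : (map_poly ratcst d).[g] != 0 ->
  ratcomp (p%:F / d%:F) g = (map_poly ratcst p).[g] / (map_poly ratcst d).[g].
Proof.
move=> dg0; set f := p%:F / d%:F; rewrite /ratcomp.
have d0 : d != 0.
  by apply: contraNneq dg0 => ->; rewrite rmorph0 horner0.
have E : ratnum f * d = p * ratden f.
  apply/eqP; rewrite -tofrac_eq !tofracM -eqr_div ?tofrac_eq0 ?ratden_neq0 //.
  by rewrite ratnum_div_ratden.
have Eg : (map_poly ratcst (ratnum f)).[g] * (map_poly ratcst d).[g]
        = (map_poly ratcst p).[g] * (map_poly ratcst (ratden f)).[g].
  by rewrite -!hornerM -!rmorphM E.
have Dg0 : (map_poly ratcst (ratden f)).[g] != 0.
  apply/negP => /eqP Dg.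
  have := coprimep_ratnum_ratden f.
  rewrite -(coprimep_map ratcst) coprimep_sym => /coprimep_root /(_ (introT eqP Dg)) Ng.
  by move/eqP: Eg; rewrite Dg mulr0 mulf_eq0 (negPf dg0) orbF (negPf Ng).
by apply/eqP; rewrite (eqr_div _ _ Dg0 dg0); apply/eqP; exact: Eg.
Qed.

End RatFun.

(* The map K(x) -> K'(x) induced by K -> K'. *)
Definition ratmap (K K' : fieldType) (iota : {rmorphism K -> K'})
    (f : {fraction {poly K}}) : {fraction {poly K'}} :=
  (map_poly iota (ratnum f))%:F / (map_poly iota (ratden f))%:F.

Lemma ratmap_frac (K K' : fieldType) (iota : {rmorphism K -> K'})
    (p d : {poly K}) : d != 0 ->
  ratmap iota (p%:F / d%:F) = (map_poly iota p)%:F / (map_poly iota d)%:F.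
Proof.
move=> d0; set f := p%:F / d%:F; rewrite /ratmap.
apply/eqP; rewrite eqr_div ?tofrac_eq0 ?map_poly_eq0 ?ratden_neq0 //.
rewrite -!tofracM -!rmorphM; apply/eqP; do 2!congr (_ _).
apply/eqP; rewrite -tofrac_eq !tofracM -eqr_div ?tofrac_eq0 ?ratden_neq0 //.
by rewrite ratnum_div_ratden.
Qed.

Lemma ratmap_inj (K K' : fieldType) (iota : {rmorphism K -> K'}) :
  injective (ratmap iota).
Proof.
move=> f g /eqP; rewrite /ratmap.
rewrite eqr_div ?tofrac_eq0 ?map_poly_eq0 ?ratden_neq0 //.
rewrite -!tofracM -!rmorphM tofrac_eq => /eqP /(map_poly_inj iota) E.
rewrite -(ratnum_div_ratden f) -(ratnum_div_ratden g).
by apply/eqP; rewrite eqr_div ?tofrac_eq0 ?ratden_neq0 // -!tofracM tofrac_eq; apply/eqP.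
Qed.

Section Redei.
Variables F L : finFieldType.
Variable iota : {rmorphism F -> L}.

Definition redei_poly (alpha : F) : {poly F} :=
  if odd #|F| then 'X^2 - alpha%:P else 'X^2 + 'X + alpha%:P.

Section Rho.
Variables beta betabar : L.

Definition rho : {fraction {poly L}} :=
  ('X - betabar%:P)%:F / ('X - beta%:P)%:F.

Definition rho_inv : {fraction {poly L}} :=
  (beta *: 'X - betabar%:P)%:F / ('X - 1)%:F.

Definition redei_ext (n : nat) : {fraction {poly L}} :=
  ratcomp rho_inv (ratcomp ('X^n)%:F rho).

Lemma ratcompXn n : ratcomp ('X^n)%:F rho = rho ^+ n.
Proof.
rewrite -[X in ratcomp X]divr1 -tofrac1 ratcomp_frac rmorph1 hornerC ?oner_eq0 //.
by rewrite divr1 map_polyXn hornerXn.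
Qed.

Lemma rho_inv_eq1 : beta = betabar -> rho_inv = (beta%:P)%:F / 1%:F.
Proof.
move=> e; rewrite /rho_inv -e; apply/eqP.
rewrite eqr_div ?tofrac_eq0 ?polyXsubC_eq0 ?oner_eq0 //.
by rewrite -!tofracM tofrac_eq mulr1 mulrBr mulr1 mul_polyC.
Qed.

Lemma redei_ext1 n : rho ^+ n = 1 ->
  redei_ext n = if beta == betabar then ratcst beta else 0.
Proof.
move=> rn; rewrite /redei_ext ratcompXn rn; case: eqVneq => [e|ne].
  rewrite rho_inv_eq1 // ratcomp_frac ?rmorph1 ?hornerC ?oner_eq0 //.
  by rewrite map_polyC hornerC divr1.
rewrite /ratcomp; set f := rho_inv.
have X1 : 'X - 1 != 0 :> {poly L} by rewrite polyXsubC_eq0.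
have E : ratnum f * ('X - 1) = (beta *: 'X - betabar%:P) * ratden f.
  apply/eqP; rewrite -tofrac_eq !tofracM -eqr_div ?tofrac_eq0 ?ratden_neq0 //.
  by rewrite ratnum_div_ratden.
have := congr1 (fun p => p.[1]) E; rewrite !hornerE subrr mulr0 => /esym/eqP.
rewrite mulf_eq0 subr_eq0 (negPf ne) /= => /eqP D1.
by rewrite -(rmorph1 (@ratcst L)) !horner_map /= D1 rmorph0 invr0 mulr0.
Qed.

Lemma redei_extE n : rho ^+ n != 1 ->
  redei_ext n =
    (beta *: ('X - betabar%:P) ^+ n - betabar *: ('X - beta%:P) ^+ n)%:F
    / (('X - betabar%:P) ^+ n - ('X - beta%:P) ^+ n)%:F.
Proof.
move=> rn; rewrite /redei_ext ratcompXn.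
have r1 : rho ^+ n - 1 != 0 by rewrite subr_eq0.
have Dr : (map_poly (@ratcst L) ('X - 1)).[rho ^+ n] = rho ^+ n - 1.
  by rewrite rmorphB /= map_polyX rmorph1 hornerD hornerN hornerX hornerC.
rewrite ratcomp_frac Dr // rmorphB /= map_polyZ /= map_polyX map_polyC.
rewrite hornerD hornerN hornerZ hornerX hornerC.
move: r1; rewrite /rho exprMn exprVn -!tofracXn.
set a := ('X - betabar%:P) ^+ n; set b := ('X - beta%:P) ^+ n => r1.
have b0 : b%:F != 0 by rewrite tofrac_eq0 expf_neq0 // polyXsubC_eq0.
have -> : a%:F / b%:F - 1 = (a - b)%:F / b%:F by rewrite tofracB mulrBl divff.
rewrite !tofracB -!mul_polyC !tofracM /ratcst.
rewrite invf_div mulrA; congr (_ / _).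
by rewrite mulrBl -!mulrA mulVf ?mulr1.
Qed.

End Rho.

Section Descent.
Hypothesis cardL : #|L| = (#|F| ^ 2)%N.

Lemma frobenius_fixed (c : L) : c ^+ #|F| = c -> exists a, iota a = c.
Proof.
move=> cE; have /(congr1 (fun p => (map_poly iota p).[c])) := finField_genPoly F.
rewrite rmorphB /= map_polyXn map_polyX hornerD hornerN hornerXn hornerX cE subrr.
rewrite rmorph_prod horner_prod => /esym/eqP/prodf_eq0[a _].
by rewrite rmorphB /= map_polyX map_polyC hornerXsubC subr_eq0 => /eqP ->; exists a.
Qed.

Lemma frobenius_descent (p : {poly L}) :
  (forall i, p`_i ^+ #|F| = p`_i) -> exists p0, map_poly iota p0 = p.
Proof.
move=> pE; have [a aE] := fin_all_exists (fun i : 'I_(size p) => frobenius_fixed (pE i)).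
exists (\poly_(i < size p) (if insub i is Some j then a j else 0)).
apply/polyP => i; rewrite coef_map coef_poly; case: ltnP => [lt|ge].
  by rewrite insubT /= aE.
by rewrite nth_default //; exact: (rmorph0 iota).
Qed.

Lemma frobenius_rmorphism :
  exists s : {rmorphism L -> L}, forall x, s x = x ^+ #|F|.
Proof.
have [p p_pr pF] := finPcharP F.
have pL : p \in [pchar L] by rewrite (fmorph_pchar iota).
have [k Fk] : exists k, #|F| = (p ^ k)%N by eexists; exact: card_pprimeChar pF.
pose s (x : L) := x ^+ #|F|.
have qn : [pchar L].-nat #|F|.
  by rewrite (eq_pnat _ (pcharf_eq pL)) Fk pnatX pnat_id.
have addS : zmod_morphism s 
  by move=> x y; apply/eqP; rewrite eq_sym subr_eq /s -exprDn_pchar // subrK.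
have mulS : monoid_morphism s by split; [exact: expr1n | move=> x y; exact: exprMn].
pose A := GRing.isZmodMorphism.Build L L s addS.
pose M := GRing.isMonoidMorphism.Build L L s mulS.
pose sRM : {rmorphism L -> L} := HB.pack s A M.
by exists sRM.
Qed.

Lemma redei_descent (beta : L) (n : nat) :
  exists R : {fraction {poly F}},
    ratmap iota R == redei_ext beta (beta ^+ #|F|) n.
Proof.
set bb := beta ^+ #|F|.
have bbE : bb ^+ #|F| = beta by rewrite -exprM mulnn -cardL expf_card.
have d1 : 1 != 0 :> {poly F} by exact: oner_neq0.
have [r1|r1] := eqVneq (rho beta bb ^+ n) 1.
  rewrite redei_ext1 //; case: eqVneq => [e|_].
    have [a aE] := frobenius_fixed (esym e).
    exists (a%:P%:F / 1%:F).
    by rewrite ratmap_frac // rmorph1 map_polyC /= aE divr1.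
  by exists (0%:F / 1%:F); rewrite ratmap_frac // rmorph0 mul0r.
have nb : beta != bb.
  apply: contraNneq r1 => e; rewrite /rho -e divff ?expr1n //.
  by rewrite tofrac_eq0 polyXsubC_eq0.
rewrite redei_extE //.
set a := ('X - bb%:P) ^+ n; set b := ('X - beta%:P) ^+ n.
have [s sE] := frobenius_rmorphism.
have sa : map_poly s a = b by rewrite rmorphXn rmorphB /= map_polyX map_polyC /= sE bbE.
have sb : map_poly s b = a by rewrite rmorphXn rmorphB /= map_polyX map_polyC /= sE.
have ss : s (beta - bb) = - (beta - bb) by rewrite rmorphB /= !sE bbE opprB.
have fixd p : map_poly s p = - p -> exists p0, map_poly iota p0 = (beta - bb) *: p.
  move=> sp; apply: frobenius_descent => i.
  rewrite -sE -coef_map map_polyZ /= sp.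
  by rewrite ss scalerN scaleNr opprK.
have [P PE] : exists P, map_poly iota P = (beta - bb) *: (beta *: a - bb *: b).
  by apply: fixd; rewrite rmorphB /= !map_polyZ /= sa sb !sE bbE opprB.
have [D DE] : exists D, map_poly iota D = (beta - bb) *: (a - b).
  by apply: fixd; rewrite rmorphB /= sa sb opprB.
have ab0 : a - b != 0.
  apply: contraNneq r1 => /eqP; rewrite subr_eq0 => /eqP e.
  rewrite /rho exprMn exprVn -!tofracXn -/a -/b e divff //.
  by rewrite tofrac_eq0 expf_neq0 // polyXsubC_eq0.
have c0 : beta - bb != 0 by rewrite subr_eq0.
have D0 : D != 0.
  by rewrite -(map_poly_eq0 iota) DE scaler_eq0 negb_or c0.
exists (P%:F / D%:F); rewrite ratmap_frac // PE DE.
have simp (u v : {poly L}) : v != 0 ->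
    ((beta - bb) *: u)%:F / ((beta - bb) *: v)%:F = u%:F / v%:F.
  move=> v0; apply/eqP; rewrite eqr_div ?tofrac_eq0 ?scaler_eq0 ?negb_or ?c0 //.
  by rewrite -!tofracM tofrac_eq -scalerAl -scalerAr.
by apply/eqP; exact: simp.
Qed.

(* The unique element of F(x) (see [ratmap_inj]) whose image in L(x) is
   rho^-1 o x^n o rho, where beta ^+ #|F| is the other root of [redei_poly]. *)
Definition redei (beta : L) (n : nat) : {fraction {poly F}} :=
  xchoose (redei_descent beta n).

Lemma redeiP (beta : L) (n : nat) :
  ratmap iota (redei beta n) = redei_ext beta (beta ^+ #|F|) n.
Proof. by apply/eqP; exact: xchooseP (redei_descent beta n). Qed.

Definition tangent_chebyshev (alpha : F) (beta : L) (n : nat) :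
    {fraction {poly F}} :=
  if odd #|F| then
    (\sum_(i < (n.-1)./2.+1)
        ('C(n, i.*2.+1)%:R * alpha ^+ i) *: 'X^(i.*2.+1))%:F /
    (\sum_(i < n./2.+1) ('C(n, i.*2)%:R * alpha ^+ i) *: 'X^(i.*2))%:F
  else ratcomp ('X)%:F^-1 (ratcomp (redei beta n) ('X)%:F^-1).

End Descent.
End Redei.

Notation mu m K := {x : K | root_of_unity m x}.

Lemma mu_pow_subproof (K : fieldType) (m n : nat) (x : mu m K) :
  root_of_unity m (val x ^+ n).
Proof. by rewrite unity_rootE exprAC (unity_rootP (valP x)) expr1n. Qed.

Definition mu_pow (K : fieldType) (m n : nat) (x : mu m K) : mu m K :=
  exist _ (val x ^+ n) (mu_pow_subproof n x).

Definition digraph_isomorphic (S T : Type) (e : rel S) (e' : rel T) : Prop :=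
  exists2 phi : S -> T, bijective phi & forall s t, e s t = e' (phi s) (phi t).

(* Main.v *)
(* Both parities are governed by the pencil identities
   D - bb N = c (1 - bb X)^n and D - b N = c (1 - b X)^n, where C_n = N/D, b is
   the root beta, bb its conjugate and c is a nonzero constant.  They make N and D
   coprime and say that the Cayley map x |-> (1 - bb x)/(1 - b x), which sends
   infinity to bb/b, conjugates C_n to the n-th power map.  Frobenius exchanges
   the numerator and the denominator of the Cayley map, so its values on the
   projective line over F_q are (q+1)-th roots of unity, and injectivity with a
   count of roots makes it a bijection onto them. *)
Require Import Defs.
From mathcomp Require Import all_boot all_order all_algebra all_field.
From mathcomp Require Import ring.

Set Implicit Arguments.
Unset Strict Implicit.
Unset Printing Implicit Defensive.

Import GRing.Theory.
Local Open Scope ring_scope.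

(** * Lowest terms, coefficient reversal and the action on the projective line *)

Section Polynomials.
Variable K : fieldType.
Implicit Types (p d u v : {poly K}) (b c : K).

(** By Gauss's lemma [d] and [v] divide each other: lowest terms are unique up to a nonzero
    constant. *)
Lemma coprimep_cross p d u v : v != 0 -> coprimep p d -> coprimep u v ->
  p * v = u * d -> exists2 c, c != 0 & p = c *: u /\ d = c *: v.
Proof.
move=> v0 pd uv E.
have dv : d %| v.
  by rewrite -(@Gauss_dvdpr _ _ p) ?E ?dvdp_mull // coprimep_sym.
have vd : v %| d.
  by rewrite -(@Gauss_dvdpr _ _ u) -?E ?dvdp_mull // coprimep_sym.
have /eqpP[[c1 c2] /= /andP[c10 c20] cE] : d %= v by rewrite /eqp dv vd.
have dE : d = (c2 / c1) *: v.
  by rewrite mulrC -scalerA -cE scalerA mulVf // scale1r.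
exists (c2 / c1); first by rewrite mulf_neq0 ?invr_eq0.
split=> //; apply: (mulIf v0).
by rewrite E dE -scalerAl -scalerAr.
Qed.

(** A common divisor of [u] and [v] divides every member [u - e *: v] of the pencil, hence both [p]
    and [d]. *)
Lemma coprimep_pencil u v p d b b' c : c != 0 -> coprimep p d ->
  u - b *: v = c *: p -> u - b' *: v = c *: d -> coprimep u v.
Proof.
move=> c0 pd Ep Ed; apply/coprimepP => g gu gv.
have gsub e : g %| u - e *: v by rewrite dvdp_sub // -mul_polyC dvdp_mull.
by move/coprimepP: pd; apply; rewrite -(dvdpZr _ _ c0) -?Ep -?Ed gsub.
Qed.

Lemma coprimep_1subZX b b' : b != 0 -> b' != 0 -> b != b' ->
  coprimep (1 - b *: 'X) (1 - b' *: 'X).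
Proof.
move=> b0 b'0 nbb'.
have E (e : K) : e != 0 -> 1 - e *: 'X = - e *: ('X - e^-1%:P).
  by move=> e0; rewrite -!mul_polyC polyCN mulNr mulrBr -polyCM divff // opprB.
rewrite !E // coprimepZl ?oppr_eq0 // coprimepZr ?oppr_eq0 //.
by rewrite coprimep_XsubC2 // subr_eq0 (inj_eq invr_inj) eq_sym.
Qed.

Lemma coef_1subZX_exp b n i :
  ((1 - b *: 'X) ^+ n)`_i = 'C(n, i)%:R * (- b) ^+ i :> K.
Proof.
have -> : (1 - b *: 'X) ^+ n = \poly_(j < n.+1) ('C(n, j)%:R * (- b) ^+ j).
  rewrite exprDn poly_def; apply: eq_bigr => j _.
  by rewrite expr1n mul1r -scaleNr exprZn scalerMnl mulr_natl.
by rewrite coef_poly; case: ltnP => // /bin_small ->; rewrite mul0r.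
Qed.

Lemma coef_XsubC_exp b n i : (i <= n)%N ->
  (('X - b%:P) ^+ n)`_i = 'C(n, i)%:R * (- b) ^+ (n - i) :> K.
Proof.
move=> le_in; rewrite addrC exprDn.
have -> : \sum_(j < n.+1) (- b%:P) ^+ (n - j) * 'X ^+ j *+ 'C(n, j) =
          \poly_(j < n.+1) ('C(n, j)%:R * (- b) ^+ (n - j)).
  rewrite poly_def; apply: eq_bigr => j _.
  by rewrite -polyCN -polyC_exp mul_polyC scalerMnl mulr_natl.
by rewrite coef_poly ltnS le_in.
Qed.

(** For [p] of degree at most [n] this is X^n p(1/X), which turns the substitution of 1/X into an
    operation on polynomials. *)
Definition revp n p : {poly K} := \poly_(i < n.+1) p`_(n - i).

Lemma revpB n p d : revp n (p - d) = revp n p - revp n d.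
Proof.
apply/polyP => i; rewrite coefB !coef_poly.
by case: ifP; rewrite ?coefB ?subr0.
Qed.

Lemma revpZ n c p : revp n (c *: p) = c *: revp n p.
Proof.
apply/polyP => i; rewrite coefZ !coef_poly.
by case: ifP; rewrite ?coefZ ?mulr0.
Qed.

Lemma revp_XsubC_exp b n : revp n (('X - b%:P) ^+ n) = (1 - b *: 'X) ^+ n.
Proof.
apply/polyP => i; rewrite coef_1subZX_exp coef_poly ltnS.
case: leqP => [le_in|/bin_small ->]; last by rewrite mul0r.
by rewrite coef_XsubC_exp ?leq_subr // bin_sub // subKn.
Qed.

Lemma horner_ratcst_Xinv n p : (size p <= n.+1)%N ->
  (map_poly (@ratcst K) p).[('X)%:F^-1] = (revp n p)%:F / ('X)%:F ^+ n.
Proof.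
move=> sz; have X0 : ('X)%:F != 0 :> {fraction {poly K}}.
  by rewrite tofrac_eq0 polyX_eq0.
apply: canRL (mulfK _) _; first by rewrite expf_neq0.
rewrite (@horner_coef_wide _ n.+1) ?size_map_poly // mulr_suml.
rewrite (reindex_inj rev_ord_inj) /revp poly_def raddf_sum.
apply: eq_bigr => i _; rewrite /= subSS coef_map /= -mul_polyC rmorphM rmorphXn /=.
rewrite -mulrA /ratcst; congr (_ * _); rewrite exprVn.
have -> : ('X)%:F ^+ n = ('X)%:F ^+ (n - i) * ('X)%:F ^+ i :> {fraction {poly K}}.
  by rewrite -exprD subnK ?leq_ord.
exact: mulKf (expf_neq0 _ X0) _.
Qed.

(* The point of the projective line with homogeneous coordinates [x : y]. *)
Definition P1_point (x y : K) : P1 K := if y == 0 then None else Some (x / y).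

(** Any coprime pair may replace the chosen [ratnum] and [ratden], since the constant between them
    cancels in every value. The size bounds and the last hypothesis make [n] the exact degree of the
    fraction, so the value at infinity is read off at index [n]. *)
Lemma P1_act_frac p d n : d != 0 -> coprimep p d ->
  (size p <= n.+1)%N -> (size d <= n.+1)%N -> (p`_n != 0) || (d`_n != 0) ->
  P1_act (p%:F / d%:F) =1
    fun x => if x is Some a then P1_point p.[a] d.[a] else P1_point p`_n d`_n.
Proof.
move=> d0 pd szp szd lead x.
have [c c0 [Ep Ed]] : exists2 c, c != 0 &
    p = c *: ratnum (p%:F / d%:F) /\ d = c *: ratden (p%:F / d%:F).
  apply: coprimep_cross; rewrite ?ratden_neq0 ?coprimep_ratnum_ratden //.
  apply/eqP; rewrite -tofrac_eq !tofracM -eqr_div ?tofrac_eq0 ?ratden_neq0 //.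
  by rewrite ratnum_div_ratden.
have kE : maxn (size p) (size d) = n.+1.
  apply/eqP; rewrite eqn_leq geq_max szp szd /= leq_max.
  case/orP: lead => h; apply/orP; [left | right]; rewrite ltnNge;
    by apply: contra h => /(nth_default 0) ->.
rewrite /P1_act; move: (ratnum _) (ratden _) Ep Ed => u v Ep Ed.
have -> : (maxn (size u) (size v)).-1 = n.
  by rewrite -(size_scale u c0) -(size_scale v c0) -Ep -Ed kE.
have divcc (y z : K) : c * y / (c * z) = y / z by rewrite -mulf_div divff ?mul1r.
by rewrite /P1_point Ep Ed; case: x => [a|];
  rewrite !(hornerZ, coefZ) mulf_eq0 (negPf c0) divcc.
Qed.

End Polynomials.

(** * The Cayley map and the conjugation to the power map *)

Section Cayley.
Variables (F L : finFieldType) (iota : {rmorphism F -> L}) (b : L).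
Hypothesis cardL : #|L| = (#|F| ^ 2)%N.
Hypothesis b_notin : forall a, iota a != b.
Let bb := b ^+ #|F|.
Implicit Types (x y a : F) (N D : {poly F}) (c : L) (n : nat).

Lemma generator_neq0 : b != 0.
Proof. by rewrite eq_sym -(rmorph0 iota). Qed.

Lemma conjugate_conjugate : bb ^+ #|F| = b.
Proof. by rewrite -exprM mulnn -cardL expf_card. Qed.

Lemma conjugate_neq0 : bb != 0.
Proof. by rewrite expf_neq0 ?generator_neq0. Qed.

Lemma conjugate_neq : bb != b.
Proof.
by apply/negP => /eqP /(frobenius_fixed iota) [a /eqP]; rewrite (negPf (b_notin a)).
Qed.

(** The Frobenius power is a ring morphism fixing the image of [F], so only the coefficient [e]
    moves. *)
Lemma frobenius_lin e x y :
  (iota y - e * iota x) ^+ #|F| = iota y - e ^+ #|F| * iota x.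
Proof.
have [s sE] := frobenius_rmorphism iota.
by rewrite -sE rmorphB rmorphM /= !sE -!(rmorphXn iota) !expf_card.
Qed.

Lemma lin_neq0 x y : (x != 0) || (y != 0) -> iota y - b * iota x != 0.
Proof.
move=> xy; apply/negP; rewrite subr_eq0 => /eqP E.
have [x0|x0] := eqVneq x 0.
  by move/eqP: E; rewrite x0 rmorph0 mulr0 fmorph_eq0; apply/negP; rewrite x0 eqxx in xy.
have := b_notin (y / x); rewrite fmorph_div E mulfK ?fmorph_eq0 //.
by rewrite eqxx.
Qed.

Lemma one_sub_neq0 a : 1 - b * iota a != 0.
Proof. by rewrite -(rmorph1 iota) lin_neq0 // oner_eq0 orbT. Qed.

Lemma conj_lin_neq0 x y : (x != 0) || (y != 0) -> iota y - bb * iota x != 0.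
Proof. by move=> xy; rewrite -frobenius_lin expf_neq0 ?lin_neq0. Qed.

Definition cayley (t : P1 F) : L :=
  if t is Some a then (1 - bb * iota a) / (1 - b * iota a) else bb / b.

(** In homogeneous coordinates one formula covers the finite points and infinity. *)
Lemma cayley_point x y : (x != 0) || (y != 0) ->
  cayley (P1_point x y) = (iota y - bb * iota x) / (iota y - b * iota x).
Proof.
rewrite /P1_point; have [-> /=|y0 _ /=] := eqVneq y 0.
  by rewrite orbF => x0; rewrite rmorph0 !sub0r invrN mulrNN -mulf_div divff
    ?mulr1 ?fmorph_eq0.
have iy0 : iota y != 0 by rewrite fmorph_eq0.
have E e : 1 - e * iota (x / y) = (iota y - e * iota x) / iota y.
  by rewrite fmorph_div mulrBl divff // mulrA.
by rewrite !E -mulf_div divff ?invr_eq0 // mulr1.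
Qed.

Lemma P1_pointP (t : P1 F) : exists x y, (x != 0) || (y != 0) /\ t = P1_point x y.
Proof.
case: t => [a|]; [exists a, 1 | exists 1, 0].
  by rewrite /P1_point oner_eq0 orbT divr1.
by rewrite /P1_point oner_eq0 eqxx.
Qed.

Lemma cayley_unity t : root_of_unity #|F|.+1 (cayley t).
Proof.
have [x [y [xy ->]]] := P1_pointP t; rewrite unity_rootE cayley_point //.
rewrite exprS expr_div_n !frobenius_lin -/bb conjugate_conjugate.
by rewrite mulrA divfK ?divff ?conj_lin_neq0 ?lin_neq0.
Qed.

(** As a Moebius map it has determinant [b - bb], nonzero because [b] lies outside the image of [F].
    After cross-multiplication each case comes down to this factor. *)
Lemma cayley_inj : injective cayley.
Proof.
have bbb : bb - b != 0 by rewrite subr_eq0 conjugate_neq.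
case=> [x|] [y|] //= /eqP; rewrite eqr_div ?one_sub_neq0 ?generator_neq0 // => /eqP E.
- congr Some; apply: (fmorph_inj iota); apply/eqP; rewrite eq_sym -subr_eq0.
  rewrite -(mulrI_eq0 _ (mulfI bbb)); move/eqP: E; rewrite -subr_eq0.
  by congr (_ == 0); ring.
- case/negP: bbb; rewrite -oppr_eq0; move/eqP: E; rewrite -subr_eq0.
  by congr (_ == 0); ring.
- by case/negP: bbb; move/eqP: E; rewrite -subr_eq0; congr (_ == 0); ring.
Qed.

Definition cayley_mu t : mu #|F|.+1 L := exist _ (cayley t) (cayley_unity t).

Lemma cayley_mu_bij : bijective cayley_mu.
Proof.
have inj : injective (cayley_mu : option F -> _).
  by move=> t u /(congr1 val) /cayley_inj.
(* The projective line has [#|F|.+1] points, and a field has at most that many roots of unity of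
   this order. *)
apply: inj_card_bij inj _; rewrite card_option cardE -(size_map val).
apply: max_unity_roots => //; last by rewrite (map_inj_uniq val_inj) enum_uniq.
by apply/allP => _ /mapP[t _ ->]; exact: valP t.
Qed.

(** If [D] were zero, the constant coefficients would give [- (e * iota N]_0) = c[for both]e =
    bb[and]e = b[; as these differ,]N[_0] and then [c] would vanish. *)
Lemma pencil_den_neq0 N D c n : c != 0 ->
  map_poly iota D - bb *: map_poly iota N = c *: (1 - bb *: 'X) ^+ n ->
  map_poly iota D - b *: map_poly iota N = c *: (1 - b *: 'X) ^+ n -> D != 0.
Proof.
move=> c0 Ebb Eb; apply: contraNneq c0 => D0.
have bbb : bb - b != 0 by rewrite subr_eq0 conjugate_neq.
have coef0E e :
    map_poly iota D - e *: map_poly iota N = c *: (1 - e *: 'X) ^+ n ->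
    - (e * iota N`_0) = c.
  move=> /(congr1 (fun p : {poly L} => p`_0)); rewrite coefB !coefZ !coef_map.
  by rewrite coef_1subZX_exp D0 coef0 /= rmorph0 sub0r bin0 !mulr1.
have N0 : iota N`_0 = 0.
  apply: (mulfI bbb); rewrite mulr0 -(subrr c) -{1}(coef0E _ Eb) -(coef0E _ Ebb).
  ring.
by rewrite -(coef0E _ Eb) N0 mulr0 oppr0.
Qed.

(** Dividing the two identities cancels [c] and gives (D - bb N)/(D - b N) = ((1 - bb X)/(1 - b
    X))^n. Finite points evaluate it; infinity compares the coefficients of degree [n]. *)
Lemma cayley_conjugates N D c n : c != 0 ->
  map_poly iota D - bb *: map_poly iota N = c *: (1 - bb *: 'X) ^+ n ->
  map_poly iota D - b *: map_poly iota N = c *: (1 - b *: 'X) ^+ n ->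
  forall t, cayley (P1_act (N%:F / D%:F) t) = cayley t ^+ n.
Proof.
move=> c0 Ebb Eb t.
have coefE e i : map_poly iota D - e *: map_poly iota N = c *: (1 - e *: 'X) ^+ n ->
    iota D`_i - e * iota N`_i = c * ('C(n, i)%:R * (- e) ^+ i).
  move=> /(congr1 (fun p : {poly L} => p`_i)).
  by rewrite coefB !coefZ !coef_map coef_1subZX_exp.
have hornerE e a : map_poly iota D - e *: map_poly iota N = c *: (1 - e *: 'X) ^+ n ->
    iota D.[a] - e * iota N.[a] = c * (1 - e * iota a) ^+ n.
  move=> /(congr1 (fun p : {poly L} => p.[iota a])).
  by rewrite hornerD hornerN !hornerZ !horner_map /= horner_exp !hornerE.
have bbb : bb - b != 0 by rewrite subr_eq0 conjugate_neq.
(* Subtracting the two pencil identities isolates [N], which bounds the degrees of [N] and [D] by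
   [n]. *)
have diffE (u v : L) : (bb - b) * v = u - b * v - (u - bb * v) by ring.
have NDi i : (n < i)%N -> N`_i = 0 /\ D`_i = 0.
  move=> lt_ni; have := coefE _ i Ebb; have := coefE _ i Eb.
  rewrite bin_small // !mul0r !mulr0 => h1 h2.
  have N0 : N`_i = 0.
    apply/eqP; rewrite -(fmorph_eq0 iota) -(mulrI_eq0 _ (mulfI bbb)).
    by rewrite (diffE (iota D`_i)) h1 h2 subrr.
  split=> //; apply/eqP; rewrite -(fmorph_eq0 iota) -h1 N0 rmorph0.
  by rewrite mulr0 subr0.
have nz e x y z : iota y - e * iota x = z -> z != 0 -> (x != 0) || (y != 0).
  move=> <-; apply: contraNT; rewrite negb_or !negbK => /andP[/eqP-> /eqP->].
  by rewrite rmorph0 mulr0 subr0.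
(* The coefficient of index [n] in D - b N is c (-b)^n, which is nonzero, so the degree [n] is
   attained. *)
have NDn : (N`_n != 0) || (D`_n != 0).
  apply: nz (coefE _ n Eb) _.
  by rewrite binn mul1r mulf_neq0 // expf_neq0 // oppr_eq0 generator_neq0.
have D0 : D != 0 := pencil_den_neq0 c0 Ebb Eb.
have cop : coprimep N D.
  rewrite -(coprimep_map iota) coprimep_sym.
  apply: coprimep_pencil c0 _ Ebb Eb.
  apply/coprimep_expl/coprimep_expr/coprimep_1subZX;
    by rewrite ?conjugate_neq0 ?generator_neq0 ?conjugate_neq.
have sz (p : {poly F}) : (forall i, (n < i)%N -> p`_i = 0) -> (size p <= n.+1)%N.
  by move=> h; apply/leq_sizeP => i /h.
rewrite (P1_act_frac (n := n)) //; try by apply: sz => i /NDi [].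
case: t => [a|] /=.
  rewrite cayley_point; last first.
    by apply: nz (hornerE _ a Eb) _; rewrite mulf_neq0 ?expf_neq0 ?one_sub_neq0.
  by rewrite !hornerE // -mulf_div divff // mul1r expr_div_n.
(* At infinity the signs cancel in (-bb)^n / (-b)^n. *)
rewrite cayley_point // !coefE // binn !mul1r -mulf_div divff // mul1r.
by rewrite -expr_div_n invrN mulrNN.
Qed.

End Cayley.

(** * Sums of even powers, and the root of the defining quadratic *)

Lemma coef_sum_even (K : fieldType) (E : nat -> K) m j :
  (\sum_(i < m) E i *: 'X^(i.*2))`_j =
  if ~~ odd j && (j./2 < m)%N then E j./2 else 0.
Proof.
have -> : \sum_(i < m) E i *: 'X^(i.*2) = (\poly_(i < m) E i) \Po 'X^2.
  rewrite poly_def raddf_sum; apply: eq_bigr => i _ /=.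
  by rewrite comp_polyZ comp_Xn_poly -exprM mul2n.
by rewrite coef_comp_poly_Xn // dvdn2 divn2 coef_poly; case: odd.
Qed.

(** An irreducible [p] has least degree among the nonzero polynomials over [F] that vanish at [b];
    if [b] came from [a], the linear polynomial ['X - a%:P] would be smaller. *)
Lemma irreducible_no_root (F L : fieldType) (iota : {rmorphism F -> L})
    (p : {poly F}) (b : L) a :
  irreducible_poly p -> (2 < size p)%N -> root (map_poly iota p) b -> iota a != b.
Proof.
move=> p_irr szp pb; apply: contraTneq szp => ab; rewrite -leqNgt.
suff: (size p <= size ('X - a%:P)%R)%N by rewrite size_XsubC.
have [p0|p0] := eqVneq p 0; first by rewrite p0 size_poly0.
move/(subfx_irreducibleP pb p0): p_irr; apply; last by rewrite polyXsubC_eq0.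
by rewrite rmorphB /= map_polyX map_polyC /= root_XsubC ab.
Qed.

Lemma size_redei_poly (F : finFieldType) (alpha : F) : size (redei_poly alpha) = 3.
Proof.
rewrite /redei_poly; case: ifP => _; first by rewrite size_XnsubC.
by rewrite -addrA size_polyDl ?size_polyXn // size_XaddC.
Qed.

(** * The pencil identities for tangent-Chebyshev functions *)

Section TangentChebyshev.
Variables (F L : finFieldType) (iota : {rmorphism F -> L}).
Hypothesis cardL : #|L| = (#|F| ^ 2)%N.
Variables (alpha : F) (b : L) (n : nat).
Hypothesis n_gt0 : (0 < n)%N.
Hypothesis b_notin : forall a, iota a != b.
Let bb := b ^+ #|F|.

(** The common interface of the two parities: [N] and [D] have coefficients in [F], while the
    identities live over [L]. *)
Definition pencil_representation (f : {fraction {poly F}}) :=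
  exists N D : {poly F}, exists2 c : L, c != 0 &
  [/\ f = N%:F / D%:F,
      map_poly iota D - bb *: map_poly iota N = c *: (1 - bb *: 'X) ^+ n
    & map_poly iota D - b *: map_poly iota N = c *: (1 - b *: 'X) ^+ n].

(** Here [bb = - b] and [b ^+ 2] is the image of [alpha]. For [e] equal to either root, the binomial
    expansion of (1 - e X)^n has even part [D] and odd part - e N, so [c] is 1. *)
Lemma tangent_chebyshev_odd : odd #|F| -> root (map_poly iota (redei_poly alpha)) b ->
  pencil_representation (tangent_chebyshev iota cardL alpha b n).
Proof.
move=> q_odd; rewrite /tangent_chebyshev /redei_poly q_odd.
rewrite rmorphB /= map_polyXn map_polyC /= rootE !hornerE subr_eq0 => /eqP b2.
(* The square of [b] lies in the image of [F], so Frobenius fixes it and can only change the sign of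
   [b]; it does not fix [b]. *)
have bbE : bb = - b.
  have /eqP : bb ^+ 2 = b ^+ 2 by rewrite exprAC b2 -rmorphXn /= expf_card.
  by rewrite eqf_sqr (negPf (conjugate_neq b_notin)) /= => /eqP.
set N := \sum_(i < _) _; set D := \sum_(i < _) _.
have DE j : D`_j = if odd j then 0 else 'C(n, j)%:R * alpha ^+ j./2.
  rewrite (coef_sum_even (fun i => 'C(n, i.*2)%:R * alpha ^+ i)).
  case: (boolP (odd j)) => //= j_even; rewrite even_halfK // ltnS.
  (* Past the summation bound the index exceeds [n], and the binomial coefficient is zero. *)
  case: leqP => // lt_nj; rewrite bin_small ?mul0r // ltnNge.
  by apply: contraL lt_nj => /half_leq; rewrite -leqNgt.
have NE j : N`_j = if odd j then 'C(n, j)%:R * alpha ^+ j./2 else 0.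
  have -> : N = 'X * \sum_(i < (n.-1)./2.+1)
      ('C(n, i.*2.+1)%:R * alpha ^+ i) *: 'X^(i.*2).
    by rewrite mulr_sumr; apply: eq_bigr => i _; rewrite -scalerAr -exprS.
  rewrite coefXM (coef_sum_even (fun i => 'C(n, i.*2.+1)%:R * alpha ^+ i)).
  case: j => [|j] //=; rewrite uphalf_half.
  case: (boolP (odd j)) => //= j_even; rewrite even_halfK // ltnS.
  case: leqP => // lt_nj; rewrite bin_small ?mul0r // ltnNge -(prednK n_gt0) ltnS.
  by apply: contraL lt_nj => /half_leq; rewrite -leqNgt.
have coefE e j : e ^+ 2 = b ^+ 2 ->
    iota D`_j - e * iota N`_j = 'C(n, j)%:R * (- e) ^+ j.
  move=> e2; have -> : (- e) ^+ j = (- e) ^+ odd j * iota alpha ^+ j./2.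
    by rewrite -{1}(odd_double_half j) exprD -mul2n exprM sqrrN e2 b2.
  rewrite DE NE; case: odd; rewrite rmorph0 rmorphM rmorph_nat rmorphXn /=; ring.
exists N, D, 1; first exact: oner_neq0.
have polyE e : e ^+ 2 = b ^+ 2 ->
    map_poly iota D - e *: map_poly iota N = 1 *: (1 - e *: 'X) ^+ n.
  move=> e2; apply/polyP => j.
  by rewrite scale1r coefB coefZ !coef_map coefE // coef_1subZX_exp.
by split=> //; apply: polyE; rewrite // bbE sqrrN.
Qed.

(** The Redei function is A/B over [L], with A - e B = (b - bb) (X - e)^n for both roots [e].
    Substituting 1/X reverses coefficients, turning (X - e)^n into (1 - e X)^n, and the outer
    inversion exchanges numerator and denominator. *)
Lemma tangent_chebyshev_even : ~~ odd #|F| ->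
  pencil_representation (tangent_chebyshev iota cardL alpha b n).
Proof.
move=> q_even; rewrite /tangent_chebyshev (negPf q_even).
have nbb : b - bb != 0 by rewrite subr_eq0 eq_sym (conjugate_neq b_notin).
set A := b *: ('X - bb%:P) ^+ n - bb *: ('X - b%:P) ^+ n.
set B := ('X - bb%:P) ^+ n - ('X - b%:P) ^+ n.
have Ebb : A - bb *: B = (b - bb) *: ('X - bb%:P) ^+ n.
  by rewrite /A /B -!mul_polyC rmorphB /=; ring.
have Eb : A - b *: B = (b - bb) *: ('X - b%:P) ^+ n.
  by rewrite /A /B -!mul_polyC rmorphB /=; ring.
(* At [b] the second power vanishes, as [n] is positive, leaving (b - bb)^n. *)
have B0 : B != 0.
  apply/eqP => /(congr1 (fun p : {poly L} => p.[b])).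
  rewrite hornerD hornerN !horner_exp !hornerXsubC subrr hornerC expr0n.
  by rewrite gtn_eqF // subr0; apply/eqP; rewrite expf_neq0.
have cop : coprimep A B.
  apply: (coprimep_pencil nbb _ Ebb Eb).
  by apply/coprimep_expl/coprimep_expr/coprimep_XsubC2.
set R := redei iota cardL b n.
(* Coprimality survives the extension to [L], so the lowest terms of [R] over [F] agree with A and B
   up to one constant. *)
have [c c0 [PE QE]] : exists2 c, c != 0 &
    map_poly iota (ratnum R) = c *: A /\ map_poly iota (ratden R) = c *: B.
  apply: coprimep_cross => //; first by rewrite coprimep_map coprimep_ratnum_ratden.
  (* Since B is nonzero, [redei_ext] is outside its degenerate case, where the inner function is the
     pole 1 of [rho_inv]. *)
  have rho_neq1 : rho b bb ^+ n != 1.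
    apply: contraNneq B0; rewrite /rho exprMn exprVn -!tofracXn => /eqP.
    rewrite -[1]divr1 eqr_div ?oner_eq0 ?tofrac_eq0 ?expf_neq0 ?polyXsubC_eq0 //.
    by rewrite mulr1 mul1r tofrac_eq => /eqP E; rewrite /B E subrr.
  have /eqP := redeiP iota cardL b n; rewrite redei_extE // /ratmap.
  rewrite eqr_div ?tofrac_eq0 ?map_poly_eq0 ?ratden_neq0 //.
  by rewrite -!tofracM tofrac_eq => /eqP.
have szL e : (size (('X - e%:P) ^+ n : {poly L}) <= n.+1)%N.
  by rewrite size_exp_XsubC.
have szA : (size A <= n.+1)%N.
  by rewrite (leq_trans (size_polyD _ _)) // size_polyN geq_max
    !(leq_trans (size_scale_leq _ _)).
have szB : (size B <= n.+1)%N.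
  by rewrite (leq_trans (size_polyD _ _)) // size_polyN geq_max !szL.
have szP : (size (ratnum R) <= n.+1)%N by rewrite -(size_map_poly iota) PE size_scale.
have szQ : (size (ratden R) <= n.+1)%N by rewrite -(size_map_poly iota) QE size_scale.
have map_revp (p : {poly F}) : map_poly iota (revp n p) = revp n (map_poly iota p).
  apply/polyP => i; rewrite coef_map [in LHS]coef_poly [RHS]coef_poly.
  by case: ifP => _; [rewrite coef_map | exact: (rmorph0 iota)].
set N := revp n (ratden R); set D := revp n (ratnum R).
have pencil e : A - e *: B = (b - bb) *: ('X - e%:P) ^+ n ->
    map_poly iota D - e *: map_poly iota N = c * (b - bb) *: (1 - e *: 'X) ^+ n.
  move=> E; rewrite !map_revp PE QE !revpZ scalerA [e * c]mulrC -2!scalerA -scalerBr.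
  by rewrite -(revpZ n e) -revpB E revpZ revp_XsubC_exp.
(* Reversal at [n] is injective on polynomials of degree at most [n]. *)
have N0 : N != 0.
  rewrite -(map_poly_eq0 iota) map_revp QE revpZ scaler_eq0 (negPf c0) /=.
  apply: contraNneq B0 => /polyP rB0; apply/eqP/polyP => i; rewrite coef0.
  case: (leqP i n) => [le_in|lt_ni]; last by rewrite nth_default ?(leq_trans szB).
  by have := rB0 (n - i)%N; rewrite coef_poly ltnS leq_subr subKn // coef0.
exists N, D, (c * (b - bb)); first by rewrite mulf_neq0.
split; [|exact: pencil|exact: pencil].
have X0 : ('X)%:F != 0 :> {fraction {poly F}} by rewrite tofrac_eq0 polyX_eq0.
have RE : ratcomp R ('X)%:F^-1 = D%:F / N%:F.
  rewrite /ratcomp (horner_ratcst_Xinv szP) (horner_ratcst_Xinv szQ).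
  by rewrite invf_div mulrA divfK; [reflexivity | exact: expf_neq0].
have D0 : D != 0.
  exact: (pencil_den_neq0 b_notin (mulf_neq0 c0 nbb) (pencil _ Ebb) (pencil _ Eb)).
(* The outer inversion needs a nonzero argument to have its intended value. *)
have DN0 : D%:F / N%:F != 0 by rewrite mulf_neq0 ?invr_eq0 ?tofrac_eq0.
have XE : (map_poly (@ratcst F) 'X).[D%:F / N%:F] = D%:F / N%:F.
  by rewrite map_polyX hornerX.
rewrite RE -[('X)%:F^-1]div1r -tofrac1 ratcomp_frac; rewrite XE //.
by rewrite rmorph1 hornerC div1r invf_div.
Qed.

End TangentChebyshev.

Theorem corollary3p7 (F L : finFieldType) (iota : {rmorphism F -> L})
    (cardL : #|L| = (#|F| ^ 2)%N)
    (alpha : F) (beta : L) (n : nat)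
    (h_irr : irreducible_poly (redei_poly alpha))
    (h_beta : root (map_poly iota (redei_poly alpha)) beta)
    (n_gt0 : (0 < n)%N) :
  digraph_isomorphic
    (frel (P1_act (tangent_chebyshev iota cardL alpha beta n)))
    (frel (@mu_pow L #|F|.+1 n)).
Proof.
have b_notin a : iota a != beta.
  by apply: irreducible_no_root h_irr _ h_beta; rewrite size_redei_poly.
have [N [D [c c0 [-> Ebb Eb]]]] :
    pencil_representation iota beta n (tangent_chebyshev iota cardL alpha beta n).
  have [q_odd|q_even] := boolP (odd #|F|).
    exact: tangent_chebyshev_odd.
  exact: tangent_chebyshev_even.
exists (cayley_mu cardL b_notin); first exact: cayley_mu_bij.
(* Injectivity carries an edge equation to the roots of unity, where conjugation turns it into one
   for the power map. *)
move=> s t /=; rewrite -(inj_eq (bij_inj (cayley_mu_bij cardL b_notin))).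
by rewrite -!(inj_eq val_inj) /= (cayley_conjugates b_notin c0 Ebb Eb).
Qed.
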